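(* There exists a Hausdorff locally convex-solid (real) vector lattice $X$ that has property (B, i) and whose topological completion $\hat X$ does not have property (B, i).
   Context: All vector lattices are real; $X_+$ denotes the positive cone. A locally solid vector lattice is a vector lattice with a linear topology having a base of neighborhoods of zero consisting of solid sets ($U$ is solid if $|x|\le |y|$, $y\in U$ imply $x\in U$); it is locally convex-solid if its topology is in addition locally convex (equivalently, it is generated by a family of lattice seminorms, i.e. seminorms $p$ with $|x|\le|y|\Rightarrow p(x)\le p(y)$). A locally solid vector lattice $X$ has property (B, i) if every sequence $(x_n)\subseteq X_+$ that is topologically bounded and increasing is (topologically) Cauchy. Topological completion: for a Hausdorff locally solid vector lattice $X$, its topological completion is the pair $(\hat X, J)$, unique up to isomorphism, where $\hat X$ is a complete (every Cauchy net converges) Hausdorff topological vector space and $J\colon X\to\hat X$ is a linear topological embedding with dense range; $\hat X$ is ordered by taking as positive cone the closure of $J(X_+)$, which makes $\hat X$ a Hausdorff locally solid vector lattice and $J$ a lattice homomorphism. *)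

(* Defs.v *)
From HB Require Import structures.
From mathcomp Require Import all_boot all_order all_algebra.
From mathcomp Require Import all_classical all_reals all_analysis.

Set Implicit Arguments.
Unset Strict Implicit.
Unset Printing Implicit Defensive.

Import Order.TTheory GRing.Theory Num.Theory.
Import numFieldNormedType.Exports.

Local Open Scope classical_set_scope.
Local Open Scope ring_scope.

(* Hierarchy-Builder rejects a join of the library's lattices with its modules
   (numeric structures already inherit from both without declaring the join), so
   suprema are provided on top of the partial order; infima are then
   [- vsup (- x) (- y)]. *)
HB.mixin Record POrderedZmodule_isVectorLattice (R : numDomainType) X
    & Num.POrderedZmodule X & GRing.Lmodule R X := {
  lev_add2r : forall z x y : X, x <= y -> x + z <= y + z ;
  scalev_ge0 : forall (a : R) (x : X), 0 <= a -> 0 <= x -> 0 <= a *: x ;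
  vsup : X -> X -> X ;
  vsup_le : forall x y z : X, (vsup x y <= z) = (x <= z) && (y <= z)
}.

#[short(type="vectorLatticeType")]
HB.structure Definition VectorLattice (R : numDomainType) :=
  {X of Num.POrderedZmodule X & GRing.Lmodule R X
      & POrderedZmodule_isVectorLattice R X}.

Definition vabs (R : numDomainType) (X : vectorLatticeType R) (x : X) : X :=
  vsup x (- x).

Definition solid (R : numDomainType) (X : vectorLatticeType R) (U : set X) :=
  forall x y : X, vabs x <= vabs y -> U y -> U x.

HB.mixin Record VectorLattice_isLocallySolid (R : numDomainType) X
    & VectorLattice R X & TopologicalLmodule R X := {
  locally_solid : forall U : set X, nbhs (0 : X) U ->
    exists V : set X, [/\ nbhs (0 : X) V, solid V & V `<=` U]
}.

#[short(type="locallySolidType")]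
HB.structure Definition LocallySolid (R : numDomainType) :=
  {X of VectorLattice R X & TopologicalLmodule R X
      & VectorLattice_isLocallySolid R X}.

Section TopologicalVectorSpaces.
Context (R : realType).
Implicit Types E F : topologicalLmodType R.

Definition locally_convex_space E :=
  forall U : set E, nbhs 0 U ->
    exists V : set E, [/\ nbhs 0 V, convex_set V & V `<=` U].

Definition topologically_bounded E (A : set E) :=
  forall U : set E, nbhs 0 U ->
    exists2 r : R, 0 < r & forall x, A x -> U (r *: x).

(* A [topologicalLmodType] carries no uniformity, and the one carried by a
   [tvsType] is not required to be translation invariant, so the library's
   [cauchy] is not the notion attached to the linear topology. *)
Definition linear_cauchy E (G : set_system E) :=
  forall U : set E, nbhs 0 U -> \forall x & y \near G, U (x - y).

(* Completeness for Cauchy nets, phrased with filters as in the library. *)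
Definition linear_complete E :=
  forall G : set_system E, ProperFilter G -> linear_cauchy G ->
    exists l : E, G --> l.

Definition linear_embedding E F (J : {linear E -> F}) :=
  injective J /\
  forall U : set E, open U <-> exists2 V : set F, open V & J @^-1` V = U.

End TopologicalVectorSpaces.

Section LocallySolid.
Context (R : realType).
Implicit Types X Y : locallySolidType R.

Definition property_B_i X :=
  forall x : nat -> X,
    (forall n, 0 <= x n) ->
    topologically_bounded (range x) ->
    nondecreasing_seq x ->
    linear_cauchy (x @ \oo).

Definition topological_completion X Y (J : {linear X -> Y}) :=
  [/\ hausdorff_space Y, linear_complete Y, linear_embedding J,
      dense (range J)
    & [set y : Y | 0 <= y] = closure (J @` [set x : X | 0 <= x])].

End LocallySolid.

(* Main.v *)
Require Import Defs.
From HB Require Import structures.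
From mathcomp Require Import all_boot all_order all_algebra.
From mathcomp Require Import all_classical all_reals all_analysis.
From mathcomp Require Import zify ring lra.

(** The example.  Let [D] be an uncountable set (the real line) and let [X]
    consist of the families [(f_i)], indexed by [D] and a further point [None],
    such that every [f_d], [d] in [D], is in l^1 and all but countably many of
    the [f_d] coincide with [f_None].  The topology is generated by the l^1 norms
    of the [f_d] and by the sup norm of [f_None].

    [X] has property (B, i): countably many elements of [X] have countably many
    exceptional indices altogether, so an increasing sequence of [X] has at
    [None] the same values as at some [d] in [D].  If the sequence is bounded,
    its values at [d] are bounded in l^1, hence Cauchy in l^1 because the norm is
    additive on the positive cone ([l1_increasing_cauchy]), and a fortiori Cauchy
    for the sup norm.  This is [cocountable_property_B_i].

    In the completion the link between [None] and [D] is lost: a neighbourhood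
    of zero constrains finitely many indices only, so the values of an element
    of [X] at finitely many [d] and at [None] can be prescribed independently.
    The completion is therefore l^1 for each [d] times c_0, and there the
    indicators of [{0, ..., n - 1}] placed at [None], with zero elsewhere, form
    a bounded increasing sequence that is not Cauchy
    ([cocountable_closure_not_property_B_i]).

    The completion is obtained for general spaces of functions on a set [S]
    whose topology is given by seminorms, called gauges below, of the form
    [sup_j (\sum_(s <- F i j) |f s|)]; both the l^1 norm and the sup norm are of
    this form.  The space of all functions with finite gauges is complete, since
    each gauge is a supremum of pointwise continuous functions and so is lower
    semicontinuous for pointwise convergence.  Hence the completion of a
    sublattice is its closure in that space ([closure_incl_completion]). *)

Set Implicit Arguments.
Unset Strict Implicit.
Unset Printing Implicit Defensive.

Import Order.TTheory GRing.Theory Num.Theory.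
Import numFieldNormedType.Exports.

Local Open Scope classical_set_scope.
Local Open Scope ring_scope.

(** * Function spaces topologized by gauges *)

Section Gauges.
Context (R : realType) (S I : choiceType) (F : I -> nat -> seq S).
Implicit Types (i : I) (l : seq I) (e : R) (f g h : S -> R).

(** The [i]-th gauge of [f] is the supremum over [j] of the sums below.  It may
    be infinite, and only upper bounds on it are ever needed, so the supremum
    itself is not formed. *)
Definition gauge_le l e f := forall i, i \in l ->
  forall j, \sum_(s <- F i j) `|f s| <= e.

Lemma gauge_le_dominated l l' e e' f g : {subset l' <= l} -> e <= e' ->
  (forall s, `|g s| <= `|f s|) -> gauge_le l e f -> gauge_le l' e' g.
Proof.
move=> ll ee gf sf i /ll il j; apply: le_trans ee.
by apply: le_trans (sf i il j); apply: ler_sum.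
Qed.

Lemma gauge_le_weaken l e e' f : e <= e' -> gauge_le l e f -> gauge_le l e' f.
Proof. by move=> ee; apply: gauge_le_dominated. Qed.

Lemma gauge_leD l a b f g h : (forall s, `|h s| <= `|f s| + `|g s|) ->
  gauge_le l a f -> gauge_le l b g -> gauge_le l (a + b) h.
Proof.
move=> hfg sf sg i il j; apply: le_trans (lerD (sf i il j) (sg i il j)).
by rewrite -big_split; apply: ler_sum.
Qed.

Lemma gauge_leZ l a c f : gauge_le l a f -> gauge_le l (`|c| * a) (c *: f).
Proof.
move=> sf i il j.
rewrite (eq_bigr (fun s => `|c| * `|f s|)) => [|s _]; last exact: normrM.
by rewrite -mulr_sumr ler_wpM2l // sf.
Qed.

Lemma gauge_le0 l e : 0 <= e -> gauge_le l e 0.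
Proof. by move=> e0 i _ j; rewrite big1// => s _; rewrite normr0. Qed.

(** Sublattices of the space of functions whose gauges are all finite. *)
Structure sublattice := Sublattice {
  carrier :> {pred S -> R};
  carrier_submod : submod_closed carrier;
  carrier_max : forall f g, f \in carrier -> g \in carrier ->
    (fun s => Num.max (f s) (g s)) \in carrier;
  carrier_bounded : forall f i, f \in carrier ->
    exists M, gauge_le [:: i] M f }.

HB.instance Definition _ (V : sublattice) :=
  GRing.isSubmodClosed.Build R (S -> R) (carrier V) (carrier_submod V).

(** A sublattice and its closure are both instances of this type, which makes the
    topology of the former the one induced by the latter. *)
Record space (V : sublattice) := Space {
  fn :> S -> R;
  fnP : fn \in V }.

Section Space.
Variable V : sublattice.
Local Notation W := (space V).
Implicit Types x y z : W.
HB.instance Definition _ := [isSub of W for @fn V].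
HB.instance Definition _ := [Choice of W by <:].
HB.instance Definition _ := [SubChoice_isSubLmodule of W by <:].

Definition le_space x y := `[< forall s, x s <= y s >].
Lemma le_space_refl : reflexive le_space.
Proof. by move=> x; apply/asboolP. Qed.
Lemma le_space_anti : antisymmetric le_space.
Proof.
move=> x y /andP[/asboolP xy /asboolP yx]; apply: val_inj.
by apply/funext => s; apply/eqP; rewrite eq_le xy yx.
Qed.
Lemma le_space_trans : transitive le_space.
Proof.
move=> y x z /asboolP xy /asboolP yz; apply/asboolP => s.
exact: le_trans (xy s) (yz s).
Qed.
HB.instance Definition _ := Order.Le_isPOrder.Build ring_display W
  le_space_refl le_space_anti le_space_trans.

Lemma leWP x y : reflect (forall s, x s <= y s) (x <= y).
Proof. exact: asboolP. Qed.

Definition sup_space x y := Space (carrier_max (fnP x) (fnP y)).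
Lemma addWE x y s : (x + y) s = x s + y s. Proof. by []. Qed.
Lemma oppWE x s : (- x) s = - x s. Proof. by []. Qed.
Lemma scaleWE (a : R) x s : (a *: x) s = a * x s. Proof. by []. Qed.
Lemma zeroWE s : (0 : W) s = 0. Proof. by []. Qed.

Lemma le_space_add2r z x y : x <= y -> x + z <= y + z.
Proof. by move=> /leWP xy; apply/leWP => s; rewrite !addWE lerD2r. Qed.
Lemma scale_space_ge0 (a : R) x : 0 <= a -> 0 <= x -> 0 <= a *: x.
Proof.
by move=> a0 /leWP x0; apply/leWP => s; rewrite scaleWE mulr_ge0 ?x0.
Qed.
Lemma sup_space_le x y z : (sup_space x y <= z) = (x <= z) && (y <= z).
Proof.
apply/leWP/andP => [xyz|[/leWP xz /leWP yz] s]; last by rewrite /= ge_max xz yz.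
by split; apply/leWP => s; have := xyz s; rewrite /= ge_max => /andP[].
Qed.
HB.instance Definition _ := POrderedZmodule_isVectorLattice.Build R W
  le_space_add2r scale_space_ge0 sup_space_le.

Lemma vsupWE x y s : vsup x y s = Num.max (x s) (y s). Proof. by []. Qed.
Lemma vabsWE x s : vabs x s = `|x s|.
Proof.
rewrite /vabs vsupWE oppWE.
by case: (ger0P (x s)) => x0; [apply/max_l|apply/max_r]; lra.
Qed.

Definition nbhs_space x : set_system W :=
  [set U | exists l e, 0 < e /\ forall y, gauge_le l e (y - x) -> U y].
HB.instance Definition _ := hasNbhs.Build W nbhs_space.


Lemma gauge_le_nbhs x l e : 0 < e -> nbhs x [set y | gauge_le l e (y - x)].
Proof. by move=> e0; exists l, e; split. Qed.

Lemma nbhs_space_filter x : ProperFilter (nbhs x).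
Proof.
apply: Build_ProperFilter_ex => [U [l [e [e0 +]]]|].
  by move/(_ x); rewrite subrr => h; exists x; apply: h; apply: gauge_le0; lra.
split.
- by exists [::], 1; split.
- move=> U U' [l [e [e0 hU]]] [l' [e' [e'0 hU']]].
  exists (l ++ l'), (Num.min e e'); split; first by rewrite lt_min e0.
  move=> y hy.
  split; [apply: hU|apply: hU']; apply: gauge_le_dominated hy => //.
  - by move=> i il; rewrite mem_cat il.
  - by rewrite ge_min lexx.
  - by move=> i il; rewrite mem_cat il orbT.
  - by rewrite ge_min lexx orbT.
- move=> U U' UU' [l [e [e0 hU]]]; exists l, e; split=> // y /hU; exact: UU'.
Qed.

Lemma nbhs_space_singleton x (U : set W) : nbhs x U -> U x.
Proof. 
by move=> [l [e [e0 +]]]; apply; rewrite subrr; apply: gauge_le0; lra.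
Qed.

Lemma nbhs_space_nbhs x (U : set W) : nbhs x U -> nbhs x (nbhs^~ U).
Proof.
move=> [l [e [e0 hU]]]; exists l, (e / 2); split=> [|y hy]; first by lra.
exists l, (e / 2); split=> [|z hz]; first by lra.
apply: hU; rewrite [e]splitr; apply: gauge_leD hz hy => s.
rewrite (_ : (z - x) s = (z - y) s + (y - x) s) ?ler_normD//.
by rewrite !(addWE, oppWE); ring.
Qed.

HB.instance Definition _ := Nbhs_isNbhsTopological.Build W
  nbhs_space_filter nbhs_space_singleton nbhs_space_nbhs.

Lemma add_space_continuous : continuous (fun z : W * W => z.1 + z.2).
Proof.
move=> [x y] U [l [e [e0 hU]]].
have e20 : 0 < e / 2 by lra.
exists ([set x' | gauge_le l (e / 2) (x' - x)],
  [set y' | gauge_le l (e / 2) (y' - y)]).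
  by split; exact: gauge_le_nbhs.
move=> [x' y'] [/= hx hy]; apply: hU.
rewrite [e]splitr; apply: gauge_leD hx hy => s.
rewrite (_ : _ s = (x' - x) s + (y' - y) s) ?ler_normD//.
by rewrite !(addWE, oppWE); lra.
Qed.

Lemma gauge_le_exists x l : exists2 M : R, 0 <= M & gauge_le l M x.
Proof.
elim: l => [|i l [M M0 IH]]; first by exists 0.
have [N hN] := carrier_bounded i (fnP x).
exists (Num.max M N) => [|k]; first by rewrite le_max M0.
rewrite inE => /orP[/eqP ->|kl] j.
- by rewrite (le_trans (hN i _ j)) ?inE// le_max lexx orbT.
- by rewrite (le_trans (IH k kl j))// le_max lexx.
Qed.

Lemma scale_space_continuous : continuous (fun z : R^o * W => z.1 *: z.2).
Proof.
move=> [a x] U [l [e [e0 hU]]].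
have [M M0 hM] := gauge_le_exists x l.
(* The bound comes from [b y - a x = b (y - x) + (b - a) x], with [|b|] at most
   [|a| + 1] since [d <= 1]. *)
pose d := Num.min 1 (e / (`|a| + 1 + M)).
have K0 : 0 < `|a| + 1 + M by rewrite ltr_wpDr// ltr_wpDl.
have d0 : 0 < d by rewrite lt_min ltr01 divr_gt0.
have dK : d * (`|a| + 1 + M) <= e by rewrite -ler_pdivlMr// ge_min lexx orbT.
exists (ball a d, [set y | gauge_le l d (y - x)]).
  by split; [exact: nbhsx_ballx|exact: gauge_le_nbhs].
move=> [b y] [/= ab hy]; apply: hU.
have {}ab : `|b - a| < d by rewrite distrC.
have b1 : `|b| <= `|a| + 1.
  rewrite -[b](subrKC a) (le_trans (ler_normD _ _))// lerD2l.
  by rewrite (le_trans (ltW ab))// ge_min lexx.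
apply: (gauge_le_weaken (e := `|b| * d + `|b - a| * M)).
  have : `|b| * d <= (`|a| + 1) * d by rewrite ler_wpM2r// ltW.
  have : `|b - a| * M <= d * M by rewrite ler_wpM2r// ltW.
  by move: dK; lra.
apply: gauge_leD (gauge_leZ b hy) (gauge_leZ (b - a) hM) => s.
rewrite (_ : _ s = (b *: (y - x)) s + ((b - a) *: x) s) ?ler_normD//.
by rewrite !(addWE, oppWE, scaleWE) /=; ring.
Qed.

HB.instance Definition _ :=
  PreTopologicalNmodule_isTopologicalNmodule.Build W add_space_continuous.
HB.instance Definition _ :=
  TopologicalNmodule_isTopologicalLmodule.Build R W scale_space_continuous.

Lemma nbhs0P (U : set W) :
  nbhs 0 U <-> exists l e, 0 < e /\ forall y : W, gauge_le l e y -> U y.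
Proof.
by split=> -[l [e [e0 hU]]]; exists l, e; split=> // y;
  [move: (hU y)|]; rewrite subr0 //; apply: hU.
Qed.

Lemma space_locally_solid (U : set W) : nbhs 0 U ->
  exists V : set W, [/\ nbhs 0 V, solid V & V `<=` U].
Proof.
move=> /nbhs0P[l [e [e0 hU]]]; exists [set y : W | gauge_le l e y]; split=> //.
- by apply/nbhs0P; exists l, e.
- move=> x y /leWP xy; apply: gauge_le_dominated => // s.
  by rewrite -!vabsWE.
Qed.
HB.instance Definition _ :=
  VectorLattice_isLocallySolid.Build R W space_locally_solid.

Lemma space_locally_convex : locally_convex_space W.
Proof.
move=> U /nbhs0P[l [e [e0 hU]]].
exists [set y : W | gauge_le l e y]; split=> //.
- by apply/nbhs0P; exists l, e.
- move=> x y t; rewrite !inE /= => hx hy.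
  have t0 : 0 <= t%:inum by [].
  have t1 : 0 <= 1 - t%:inum by rewrite subr_ge0.
  rewrite (_ : e = `|t%:inum| * e + `|1 - t%:inum| * e); last first.
    by rewrite !ger0_norm//; ring.
  by apply: gauge_leD (gauge_leZ _ hx) (gauge_leZ _ hy) => s; exact: ler_normD.
Qed.

Lemma space_bounded (A : set W) : topologically_bounded A <->
  forall i, exists M, forall x, A x -> gauge_le [:: i] M x.
Proof.
split=> [bA i|bA U /nbhs0P[l [e [e0 hU]]]].
  have /bA[r r0 hr] : nbhs 0 [set y : W | gauge_le [:: i] 1 y].
    by apply/nbhs0P; exists [:: i], 1.
  exists (`|r^-1| * 1) => x /hr /(gauge_leZ r^-1) /=.
  by rewrite scalerA mulVf ?scale1r// gt_eqF.
have [M M0 hM] : exists2 M, 0 < M & forall x, A x -> gauge_le l M x.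
  elim: l {hU} => [|i l [M M0 IH]]; first by exists 1.
  have [N hN] := bA i.
  exists (Num.max M N) => [|x Ax k]; first by rewrite lt_max M0.
  rewrite inE => /orP[/eqP ->|kl] j.
  - by rewrite (le_trans (hN x Ax i _ j)) ?inE// le_max lexx orbT.
  - by rewrite (le_trans (IH x Ax k kl j))// le_max lexx.
exists (e / M) => [|x Ax]; first exact: divr_gt0.
apply: hU; apply: gauge_le_weaken (gauge_leZ _ (hM x Ax)).
by rewrite ger0_norm ?divfK ?gt_eqF// ltW// divr_gt0.
Qed.

Lemma space_cauchy (G : set_system W) : Filter G -> (linear_cauchy G <->
  forall l e, 0 < e ->
    exists2 A, G A & forall x y, A x -> A y -> gauge_le l e (x - y)).
Proof.
move=> FG; split=> [cG l e e0|cG U /nbhs0P[l [e [e0 hU]]]].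
  have /cG[[A B] [/= GA GB] AB] : nbhs 0 [set y : W | gauge_le l e y].
    by apply/nbhs0P; exists l, e.
  exists (A `&` B); first exact: filterI.
  by move=> x y [Ax _] [_ By]; exact: (AB (x, y)).
have [A GA hA] := cG l e e0; exists (A, A) => // -[x y] [/= Ax Ay].
by apply: hU; exact: hA.
Qed.


Lemma space_cauchy_seq (x : nat -> W) : linear_cauchy (x @ \oo) <->
  forall i e, 0 < e -> exists N, forall n n', (N <= n)%N -> (N <= n')%N ->
    gauge_le [:: i] e (x n - x n').
Proof.
rewrite space_cauchy; split=> [cx i e /(cx [:: i])[A [N _ hN] hA]|cx l e e0].
  by exists N => n n' Nn Nn'; apply: hA; apply: hN.
have [N hN] : exists N, forall n n', (N <= n)%N -> (N <= n')%N ->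
    gauge_le l e (x n - x n').
  elim: l => [|i l [N hN]]; first by exists 0.
  have [N' hN'] := cx i e e0; exists (maxn N N') => n n'.
  rewrite !geq_max => /andP[Nn N'n] /andP[Nn' N'n'] k.
  rewrite inE => /orP[/eqP ->|kl]; last exact: hN.
  by apply: hN' => //; rewrite inE.
exists (x @` [set n | (N <= n)%N]); first by exists N => // n Nn; exists n.
by move=> _ _ [n Nn <-] [n' Nn' <-]; exact: hN.
Qed.

End Space.

(** * The closure of a sublattice is its completion *)

Section Closure.
Variable V : sublattice.

(** The closure of [V] in the space of functions with finite gauges: finiteness
    of the gauges of [f] follows from that of the gauges of a nearby element of
    [V] ([approximable_bounded]). *)
Definition approximable : {pred S -> R} := [pred f | `[< forall l e, 0 < e ->
  exists2 g, g \in V & gauge_le l e (f - g) >] ].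

Lemma approximableP f : reflect
  (forall l e, 0 < e -> exists2 g, g \in V & gauge_le l e (f - g))
  (f \in approximable).
Proof. exact: asboolP. Qed.

Lemma approximable_submod : submod_closed approximable.
Proof.
split=> [|a f g /approximableP hf /approximableP hg].
  apply/approximableP => l e e0; exists 0; first exact: rpred0.
  by rewrite subrr; apply: gauge_le0; exact: ltW.
apply/approximableP => l e e0.
have a0 : 0 < `|a| + 1 by rewrite ltr_wpDl.
have [|f' Vf' sf] := hf l (e / 2 / (`|a| + 1)); first by rewrite !divr_gt0.
have [|g' Vg' sg] := hg l (e / 2); first by rewrite divr_gt0.
exists (a *: f' + g'); first by rewrite rpredD// rpredZ.
apply: (gauge_le_weaken (e := `|a| * (e / 2 / (`|a| + 1)) + e / 2)).
  rewrite [leRHS]splitr lerD2r mulrCA ger_pMr ?divr_gt0//.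
  by rewrite ler_pdivrMr// mul1r lerDl.
apply: gauge_leD (gauge_leZ a sf) sg => s.
rewrite (_ : _ s = (a *: (f - f')) s + (g - g') s) ?ler_normD//.
by rewrite /= !fctE /=; ring.
Qed.

Lemma dist_max_le (a b c d : R) :
  `|Num.max a b - Num.max c d| <= `|a - c| + `|b - d|.
Proof.
have := ler_norm (a - c); have := ler_norm (b - d).
have := ler_norm (c - a); have := ler_norm (d - b).
rewrite ![`|_ - a|]distrC ![`|_ - b|]distrC ler_norml.
by case: (leP a b); case: (leP c d); lra.
Qed.

Lemma approximable_max f g : f \in approximable -> g \in approximable ->
  (fun s => Num.max (f s) (g s)) \in approximable.
Proof.
move=> /approximableP hf /approximableP hg; apply/approximableP => l e e0.
have [|f' Vf' sf] := hf l (e / 2); first by rewrite divr_gt0.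
have [|g' Vg' sg] := hg l (e / 2); first by rewrite divr_gt0.
exists (fun s => Num.max (f' s) (g' s)); first exact: carrier_max.
by rewrite [e]splitr; apply: gauge_leD sf sg => s; exact: dist_max_le.
Qed.

Lemma approximable_bounded f i : f \in approximable ->
  exists M, gauge_le [:: i] M f.
Proof.
move=> /approximableP /(_ [:: i] 1 ltr01)[g /(carrier_bounded i)[M hM] hfg].
exists (1 + M); apply: gauge_leD hfg hM => s.
by rewrite -{1}[f s](subrK (g s)) ler_normD.
Qed.

Definition closure_sublattice := Sublattice approximable_submod
  approximable_max approximable_bounded.

Lemma sub_closure_sublattice f : f \in V -> f \in closure_sublattice.
Proof.
move=> Vf; apply/approximableP => l e e0; exists f => //.
by rewrite subrr; apply: gauge_le0; exact: ltW.
Qed.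

Definition closure_incl (x : space V) : space closure_sublattice :=
  Space (sub_closure_sublattice (fnP x)).

Lemma closure_incl_linear : linear closure_incl.
Proof. by move=> a x y; apply: val_inj. Qed.

HB.instance Definition _ := GRing.isLinear.Build R (space V)
  (space closure_sublattice) *:%R closure_incl closure_incl_linear.

End Closure.

(** Gauges that see every point of [S] dominate the evaluations, so convergence
    implies pointwise convergence; this gives separation, pointwise limits and
    the closedness of the positive cone. *)
Section Separated.
Hypothesis F_cover : forall s, exists i j, s \in F i j.

Lemma gauge_le_coord s :
  exists i, forall e f, gauge_le [:: i] e f -> `|f s| <= e.
Proof.
have [i [j sij]] := F_cover s; exists i => e f /(_ i (mem_head _ _) j).
apply: le_trans; rewrite (big_rem s)//= lerDl.
by apply: sumr_ge0.
Qed.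

Lemma space_hausdorff (V : sublattice) : hausdorff_space (space V).
Proof.
move=> x y xy; apply: val_inj; apply/funext => s.
have [i hi] := gauge_le_coord s.
apply/eqP; rewrite -subr_eq0 -normr_le0; apply/ler_addgt0Pr => e e0.
have e20 : 0 < e / 2 by rewrite divr_gt0.
have [z [/= /hi zx /hi zy]] :=
  xy _ _ (gauge_le_nbhs x [:: i] e20) (gauge_le_nbhs y [:: i] e20).
rewrite add0r (_ : _ - _ = (z - y) s - (z - x) s); last first.
  by rewrite !(addWE, oppWE); ring.
by rewrite [e]splitr (le_trans (ler_normB _ _))// lerD.
Qed.

(** A Cauchy filter converges pointwise, and an upper bound on a gauge passes to
    pointwise limits since it only involves finite sums; so the limit is
    approximated, in the gauges, by members of the filter. *)
Lemma closure_complete (V : sublattice) :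
  linear_complete (space (closure_sublattice V)).
Proof.
move=> G PG /space_cauchy cG.
have cvgs s : cvg ((fun x : space (closure_sublattice V) => x s) @ G).
  apply/cauchy_cvgP/cauchyP => e e0; have [i hi] := gauge_le_coord s.
  have e20 : 0 < e / 2 by rewrite divr_gt0.
  have [A GA hA] := cG [:: i] _ e20.
  have [x Ax] := filter_ex GA.
  exists (x s); suff : G [set y | ball (x s) e (y s)] by [].
  apply: filterS GA => y Ay.
  rewrite /ball /= (le_lt_trans (hi _ _ (hA x y Ax Ay)))//.
  by rewrite ltr_pdivrMr// ltr_pMr// ltr1n.
pose L s : R := lim ((fun x : space (closure_sublattice V) => x s) @ G).
have near_sum (r : seq S) e : 0 < e ->
    G [set x | \sum_(s <- r) `|x s - L s| <= e].
  elim: r e => [|s r IH] e e0.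
    by apply: nearW => x /=; rewrite big_nil ltW.
  have e20 : 0 < e / 2 by rewrite divr_gt0.
  have /cvgrPdist_le/(_ _ e20) := cvgs s.
  apply: filterS2 (IH _ e20) => x hr hs.
  by rewrite /= big_cons [e]splitr lerD// distrC.
have leL l e A : G A -> (forall x y, A x -> A y -> gauge_le l e (x - y)) ->
    forall x, A x -> gauge_le l e (fn x - L).
  move=> GA hA x Ax i il j; apply/ler_addgt0Pr => d d0.
  have [y [Ay hy]] := filter_ex (filterI GA (near_sum (F i j) d d0)).
  apply: le_trans (lerD (hA x y Ax Ay i il j) hy).
  rewrite -big_split; apply: ler_sum => s _ /=.
  rewrite (_ : _ s = (x - y) s + (y s - L s)) ?ler_normD//.
  by rewrite !(addWE, oppWE) !fctE; ring.
have LV : L \in closure_sublattice V.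
  apply/approximableP => l e e0.
  have e20 : 0 < e / 2 by rewrite divr_gt0.
  have [A GA hA] := cG l _ e20; have [x Ax] := filter_ex GA.
  have [g Vg xg] := approximableP _ _ (fnP x) l _ e20.
  exists g => //; rewrite [e]splitr.
  apply: gauge_leD (leL _ _ _ GA hA x Ax) xg => s.
  rewrite (_ : _ s = (fn x - g) s - (fn x - L) s); last by rewrite !fctE; ring.
  by rewrite [leRHS]addrC ler_normB.
exists (Space LV) => U [l [e [e0 hU]]].
have [A GA hA] := cG l e e0; apply: (filterS _ (GA)) => x Ax; apply: hU.
exact: leL GA hA x Ax.
Qed.

Lemma closure_incl_embedding (V : sublattice) :
  linear_embedding (@closure_incl V).
Proof.
split=> [x y /(congr1 val) xy|U]; first exact: val_inj.
split=> [oU|[A oA <-]].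
  (* The largest set with trace inside [U]; its interior contains the image of
     [U] because a gauge takes the same value on [x] and on its image. *)
  exists ([set y | forall x, closure_incl x = y -> U x]^°).
    exact: open_interior.
  apply/seteqP; split=> x /=; first by move/interior_subset; exact.
  move=> Ux; have [l [e [e0 hU]]] : nbhs x U by exact: open_nbhs_nbhs.
  exists l, e; split=> // y hy x' x'y; apply: hU.
  by move: hy; rewrite -x'y.
rewrite openE => x /= Ax.
have [l [e [e0 hU]]] : nbhs (closure_incl x) A by exact: open_nbhs_nbhs.
by exists l, e; split=> // y hy; exact: hU.
Qed.

Lemma closure_incl_dense (V : sublattice) : dense (range (@closure_incl V)).
Proof.
move=> A [y Ay] oA.
have [l [e [e0 hA]]] : nbhs y A by exact: open_nbhs_nbhs.
have [g Vg yg] := approximableP _ _ (fnP y) l e e0.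
exists (closure_incl (Space Vg)); split; last by exists (Space Vg).
by apply: hA; apply: gauge_le_dominated yg => // s; rewrite !fctE distrC.
Qed.

(** Replacing an approximant of a positive element by its positive part keeps it
    in [V] and does not increase the error. *)
Lemma closure_incl_cone (V : sublattice) :
  [set y : space (closure_sublattice V) | 0 <= y] =
  closure (@closure_incl V @` [set x | 0 <= x]).
Proof.
apply/seteqP; split=> y /=.
  move=> /leWP y0 A [l [e [e0 hA]]].
  have [g Vg yg] := approximableP _ _ (fnP y) l e e0.
  exists (closure_incl (vsup (Space Vg) 0)); split.
    exists (vsup (Space Vg) 0) => //; apply/leWP => s.
    by rewrite vsupWE le_max lexx orbT.
  apply: hA; apply: gauge_le_dominated yg => // s.
  rewrite !(addWE, oppWE) [closure_incl _ s]vsupWE /= !fctE.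
  have := dist_max_le (g s) 0 (y s) 0.
  by rewrite subrr normr0 addr0 (max_l (y0 s)) [`|y s - _|]distrC.
move=> cly; apply/leWP => s; have [i hi] := gauge_le_coord s.
apply/ler_addgt0Pr => e e0.
have [_ [[x /leWP x0 <-] /hi xy]] := cly _ (gauge_le_nbhs y [:: i] e0).
have : `|x s - y s| <= e by exact: xy.
by have := x0 s; rewrite !zeroWE ler_norml => xs0 /andP[_]; lra.
Qed.

Theorem closure_incl_completion (V : sublattice) :
  topological_completion (@closure_incl V : {linear _ -> _}).
Proof.
split; [exact: space_hausdorff|exact: closure_complete
  |exact: closure_incl_embedding|exact: closure_incl_dense
  |exact: closure_incl_cone].
Qed.

End Separated.
End Gauges.

(** * The example *)

Lemma countableU (T : Type) (A B : set T) :
  countable A -> countable B -> countable (A `|` B).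
Proof.
move=> cA cB; rewrite -bigcup2E; apply: bigcup_countable => // -[|[|n]] _ //.
Qed.

Section Example.
Variable R : realType.
Let S : choiceType := (option R * nat)%type.

(** With these windows the gauge at [Some d] is the l^1 norm of
    [m |-> f (Some d, m)], and the gauge at [None] is the sup norm of
    [m |-> f (None, m)]. *)
Definition window (i : option R) (k : nat) : seq S :=
  if i is Some _ then [seq (i, m) | m <- index_iota 0 k] else [:: (i, k)].

Lemma window_cover s : exists i j, s \in window i j.
Proof.
case: s => -[d|] m; last by exists None, m; rewrite inE.
exists (Some d), m.+1; apply/mapP; exists m => //.
by rewrite mem_index_iota leq0n ltnSn.
Qed.

Lemma window_index i j s : s \in window i j -> s.1 = i.
Proof.
by case: i => [d /mapP[m _ ->]|]//; rewrite inE => /eqP ->.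
Qed.

Lemma gauge_window_Some d e (f : S -> R) :
  gauge_le window [:: Some d] e f <->
  forall k, \sum_(0 <= m < k) `|f (Some d, m)| <= e.
Proof.
split=> [h k|h i]; first by have := h _ (mem_head _ _) k; rewrite big_map.
by rewrite inE => /eqP -> k; rewrite big_map.
Qed.

Lemma gauge_window_None e (f : S -> R) :
  gauge_le window [:: None] e f <-> forall m, `|f (None, m)| <= e.
Proof.
split=> [h m|h i]; first by have := h _ (mem_head _ _) m; rewrite big_seq1.
by rewrite inE => /eqP -> m; rewrite big_seq1.
Qed.

Definition cocountably_constant : {pred S -> R} := [pred f | `[<
  (forall i, exists M, gauge_le window [:: i] M f) /\
  (exists2 C : set R, countable C &
    forall d, ~ C d -> forall m, f (Some d, m) = f (None, m)) >] ].

Lemma cocountably_constant_submod : submod_closed cocountably_constant.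
Proof.
split=> [|a f g /asboolP[bf [C cC fC]] /asboolP[bg [D cD gD]]].
  apply/asboolP; split=> [i|]; first by exists 0; exact: gauge_le0.
  by exists set0.
apply/asboolP; split=> [i|].
  have [M hM] := bf i; have [N hN] := bg i; exists (`|a| * M + N).
  by apply: gauge_leD (gauge_leZ a hM) hN => s; exact: ler_normD.
exists (C `|` D); first by rewrite countableU.
move=> d /not_orP[Cd Dd] m.
by have := fC d Cd m; have := gD d Dd m; rewrite !fctE => -> ->.
Qed.

Lemma cocountably_constant_max f g :
  f \in cocountably_constant -> g \in cocountably_constant ->
  (fun s => Num.max (f s) (g s)) \in cocountably_constant.
Proof.
move=> /asboolP[bf [C cC fC]] /asboolP[bg [D cD gD]].
apply/asboolP; split=> [i|].
  have [M hM] := bf i; have [N hN] := bg i; exists (M + N).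
  apply: gauge_leD hM hN => s.
  by have := dist_max_le (f s) (g s) 0 0; rewrite maxxx !subr0.
exists (C `|` D); first by rewrite countableU.
by move=> d /not_orP[Cd Dd] m; rewrite fC// gD.
Qed.

Lemma cocountably_constant_bounded f i :
  f \in cocountably_constant -> exists M, gauge_le window [:: i] M f.
Proof. by move=> /asboolP[]. Qed.

Definition cocountable_sublattice : sublattice R window :=
  Sublattice cocountably_constant_submod
    cocountably_constant_max cocountably_constant_bounded.

(** A countable set is Lebesgue negligible, the unit interval is not. *)
Lemma real_uncountable : ~ countable [set: R].
Proof.
move=> /countable_lebesgue_measure0 h.
have : (lebesgue_measure (`[0%R, 1%R]%classic : set R) <=
        lebesgue_measure [set: R])%E.
  by apply: le_measure; rewrite ?inE.
by rewrite [leRHS]h lebesgue_measure_itv /= lte01 lee_fin; lra.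
Qed.

(** The l^1 norm has property (B, i).  For [n' <= n] the distance between the
    terms is the difference of their sums, because the terms are positive and
    increasing; it is small once the sums are close to their supremum. *)
Lemma l1_increasing_cauchy (a : nat -> nat -> R) (M : R) :
  (forall n m, 0 <= a n m) ->
  (forall m, {homo a^~ m : n n' / (n <= n')%N >-> n <= n'}) ->
  (forall n k, \sum_(0 <= m < k) a n m <= M) ->
  forall e, 0 < e -> exists N, forall n n', (N <= n)%N -> (N <= n')%N ->
    forall k, \sum_(0 <= m < k) `|a n m - a n' m| <= e.
Proof.
move=> a0 ai aM e e0.
pose P := [set \sum_(0 <= m < k) a n m | n in [set: nat] & k in [set: nat]].
have hP : has_sup P.
  split; first by exists (\sum_(0 <= m < 0) a 0 m); exists 0 => //; exists 0.
  by exists M => _ [n _ [k _ <-]].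
have [_ [N _ [K _ <-]] hNK] := sup_adherent e0 hP.
exists N; suff main n n' : (N <= n')%N -> (n' <= n)%N ->
    forall k, \sum_(0 <= m < k) `|a n m - a n' m| <= e.
  move=> n n' Nn Nn' k; case: (leqP n' n) => nn'; first exact: main.
  under eq_bigr do rewrite distrC.
  by apply: main => //; exact: ltnW.
move=> Nn' nn' k.
have grow (b : nat -> R) j j' : (forall m, 0 <= b m) -> (j <= j')%N ->
    \sum_(0 <= m < j) b m <= \sum_(0 <= m < j') b m.
  by move=> b0 jj'; rewrite (big_cat_nat _ jj')//= lerDl; apply: sumr_ge0.
(* Past [K], the partial sums of the [n']-th term are within [e] of [sup P]. *)
apply: le_trans (grow _ k (maxn k K) _ (leq_maxl _ _)) _ => //.
rewrite (eq_bigr (fun m => a n m - a n' m)) => [|m _]; last first.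
  by rewrite ger0_norm// subr_ge0; exact: ai.
rewrite sumrB lerBlDr -lerBlDl.
have h1 : \sum_(0 <= m < maxn k K) a n m <= sup P.
  by apply: sup_upper_bound => //; exists n => //; exists (maxn k K).
have h2 : \sum_(0 <= m < K) a N m <= \sum_(0 <= m < maxn k K) a n' m.
  apply: le_trans (grow _ K (maxn k K) _ (leq_maxr _ _)) => //.
  by apply: ler_sum => m _; exact: ai.
by move: hNK h1 h2; lra.
Qed.

Theorem cocountable_property_B_i : property_B_i (space cocountable_sublattice).
Proof.
move=> x x0 /space_bounded bx incx; apply/space_cauchy_seq.
have inc s n n' : (n <= n')%N -> x n s <= x n' s.
  by move=> /incx /leWP; exact.
have cauchy_Some d e : 0 < e ->
    exists N, forall n n', (N <= n)%N -> (N <= n')%N ->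
    gauge_le window [:: Some d] e (x n - x n').
  have [M hM] := bx (Some d).
  have xpos n m : 0 <= x n (Some d, m) by have /leWP := x0 n; exact.
  move=> /(l1_increasing_cauchy (a := fun n m => x n (Some d, m)) (M := M)).
  case=> [n m //|m n n' /inc //|n k|N hN].
    have /gauge_window_Some/(_ k) := hM (x n) (ex_intro2 _ _ n I erefl).
    by under eq_bigr do rewrite ger0_norm//.
  by exists N => n n' Nn Nn'; apply/gauge_window_Some; exact: hN.
case=> [|e e0]; first exact: cauchy_Some.
(* The index [d] avoids the exceptional sets of all the [x n]. *)
have [d hd] : exists d, forall n m, x n (Some d, m) = x n (None, m).
  have /choice[C hC] n : exists C : set R, countable C /\
      forall d, ~ C d -> forall m, x n (Some d, m) = x n (None, m).
    by have /asboolP[_ [C cC hC]] := fnP (x n); exists C.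
  have /existsNP[d Cd] : ~ forall d, (\bigcup_n C n) d.
    move=> CT; apply: real_uncountable.
    rewrite (_ : setT = \bigcup_n C n); last by apply/seteqP; split=> // d _.
    by apply: bigcup_countable => // n _; have [] := hC n.
  exists d => n m; have [_] := hC n; apply.
  by move=> Cnd; apply: Cd; exists n.
have [N hN] := cauchy_Some d e e0; exists N => n n' Nn Nn'.
apply/gauge_window_None => m.
have /gauge_window_Some/(_ m.+1) := hN n n' Nn Nn'.
rewrite big_nat_recr//; apply: le_trans.
have -> : (x n - x n') (Some d, m) = (x n - x n') (None, m).
  by rewrite !(addWE, oppWE) !hd.
by rewrite lerDr sumr_ge0.
Qed.

Lemma sum_indicator_le n k : \sum_(0 <= m < k) (m < n)%N%:R <= n%:R :> R.
Proof.
suff -> : \sum_(0 <= m < k) (m < n)%N%:R = (minn k n)%:R :> R.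
  by rewrite ler_nat geq_minr.
elim: k => [|k IH]; first by rewrite big_nil min0n.
rewrite big_nat_recr//= IH -natrD; congr _%:R.
by lia.
Qed.

(** The indicator of [{0, ..., n - 1}], placed at the index [None]. *)
Definition unit_block (n : nat) : S -> R :=
  fun s => if s.1 is None then (s.2 < n)%N%:R else 0.

(** Among the gauges in a finite list [l], the approximant may differ from
    [unit_block n] only at the indices outside [l]: it vanishes at the indices
    of [D] in [l], which are finitely many, and everywhere else it is the
    indicator placed at [None]. *)
Lemma unit_block_closure n :
  unit_block n \in closure_sublattice cocountable_sublattice.
Proof.
apply/approximableP => l e e0.
exists (fun s => if (s.1 != None) && (s.1 \in l) then 0 else (s.2 < n)%N%:R).
  apply/asboolP; split=> [[d|]|].
  - exists n%:R; apply/gauge_window_Some => k.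
    apply: le_trans (sum_indicator_le n k); apply: ler_sum => m _.
    by case: ifP; rewrite ?normr0 ?normr_nat.
  - exists 1; apply/gauge_window_None => m /=.
    by case: ltnP; rewrite ?normr1 ?normr0.
  - exists [set d | Some d \in l]; last by move=> d /negP/negbTE /= ->.
    apply: finite_set_countable.
    rewrite (_ : mkset _ = [set` pmap id l]); first exact: finite_seq.
    by apply/seteqP; split=> d /=; rewrite mem_pmap map_id.
move=> i il j; rewrite big_seq big1 ?ltW// => -[i' m] /window_index /= ->.
rewrite !fctE /= /unit_block /=.
by case: i il => [d ->|_]; rewrite subrr normr0.
Qed.

Theorem cocountable_closure_not_property_B_i :
  ~ property_B_i (space (closure_sublattice cocountable_sublattice)).
Proof.
pose y n := Space (unit_block_closure n).
have y0 n : 0 <= y n by apply/leWP => -[[d|] m] /=.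
have incy : nondecreasing_seq y.
  move=> n n' nn'; apply/leWP => -[[d|] m] //=.
  rewrite /unit_block /= ler_nat; case: ltnP => // mn.
  by rewrite (leq_trans mn nn').
have bndy : topologically_bounded (range y).
  apply/space_bounded => -[d|]; exists 1 => _ [n _ <-].
    by apply/gauge_window_Some => k; rewrite big1// => m _; rewrite normr0.
  apply/gauge_window_None => m; rewrite /= /unit_block /=.
  by case: ltnP; rewrite ?normr1 ?normr0.
move=> /(_ y y0 bndy incy) /space_cauchy_seq /(_ None (1 / 2)).
case=> [|N /(_ N.+1 N (leqnSn N) (leqnn N))]; first by lra.
move=> /gauge_window_None /(_ N).
rewrite addWE oppWE /= /unit_block /= ltnSn ltnn subr0 normr1; lra.
Qed.

End Example.

Theorem theorem3p6 (R : realType) :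
  exists X : locallySolidType R,
    [/\ hausdorff_space X, locally_convex_space X, property_B_i X
      & exists (Y : locallySolidType R) (J : {linear X -> Y}),
          topological_completion J /\ ~ property_B_i Y].
Proof.
exists (space (cocountable_sublattice R)); split.
- exact/space_hausdorff/window_cover.
- exact: space_locally_convex.
- exact: cocountable_property_B_i.
exists (space (closure_sublattice (cocountable_sublattice R))).
exists (@closure_incl _ _ _ _ _).
split; last exact: cocountable_closure_not_property_B_i.
exact/closure_incl_completion/window_cover.
Qed.
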